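(* Let $H$ be a finite hypergraph with vertex set $V(H)$ and edge set $E(H)$, having no edges of size $0$ or $1$. Suppose that every vertex $v\in V(H)$ is assigned a list $L(v)\subset\mathbb{R}$ with $|L(v)|=2$ and every edge $e\in E(H)$ is assigned a list $L(e)\subset\mathbb{R}$ with $|L(e)|=3$. Then there exists a weighting $\omega: V(H)\cup E(H)\to\mathbb{R}$ with $\omega(z)\in L(z)$ for every $z\in V(H)\cup E(H)$, such that the induced total vertex weights $$w(v):=\omega(v)+\sum_{e\in E(H),\, e\ni v}\omega(e),\qquad v\in V(H),$$ properly color $V(H)$.
   Context: A hypergraph $H$ consists of a finite vertex set $V(H)$ and a set $E(H)$ of subsets of $V(H)$, called edges; the size of an edge is its number of vertices. A vertex coloring of a hypergraph is proper if there is no monochromatic edge. Thus the total vertex weights $w$ properly color $V(H)$ if every edge $e\in E(H)$ contains two vertices $x,y\in e$ with $w(x)\neq w(y)$. In $V(H)\cup E(H)$, vertices and edges are regarded as distinct objects (disjoint union). *)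

(* Defs.v *)
From HB Require Import structures.
From mathcomp Require Import all_boot all_order all_algebra.
From mathcomp Require Import finmap reals.

Set Implicit Arguments.
Unset Strict Implicit.
Unset Printing Implicit Defensive.

Import GRing.Theory.
Local Open Scope ring_scope.

Record hypergraph := Hypergraph {
  vertices : finType;
  edges : {set {set vertices}}
}.

Notation edge_of H := {e : {set vertices H} | e \in edges H}.

(* [V(H) ∪ E(H)] is a sum type, so vertices and edges are always distinct. *)
Notation objects H := (vertices H + edge_of H)%type.

Definition total_weight (R : realType) (H : hypergraph)
    (omega : objects H -> R) (v : vertices H) : R :=
  omega (inl v) + \sum_(e : edge_of H | v \in val e) omega (inr e).

Definition proper_coloring (C : Type) (H : hypergraph)
    (c : vertices H -> C) : Prop :=
  forall e : {set vertices H}, e \in edges H ->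
    exists x y, [/\ x \in e, y \in e & c x <> c y].

(* Main.v *)
Require Import Defs.
From HB Require Import structures.
From mathcomp Require Import all_boot all_order all_algebra.
From mathcomp Require Import finmap reals.
From mathcomp Require Import ring.

Set Implicit Arguments.
Unset Strict Implicit.
Unset Printing Implicit Defensive.

Import GRing.Theory.
Local Open Scope ring_scope.

(**
The theorem follows the polynomial method of Wong and Zhu for graphs.  Order
the vertices, let x_e and y_e be the two least vertices of an edge e, and ask
for w(x_e) <> w(y_e) for every e.  Edges with the same pair ask for the same
thing, so one representative edge per pair suffices; the representatives
then form a simple graph, and this is what makes the induction below work.

Over the representatives, the product of the differences w(y_e) - w(x_e) is
a product of linear forms in the variables omega(z), one per vertex or edge.
By the Combinatorial Nullstellensatz it is nonzero somewhere on the product of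
the lists as soon as some monomial of top degree, of degree at most 1 in each
vertex variable and at most 2 in each edge variable, has a nonzero
coefficient.  Up to factorials that coefficient is the permanent of the matrix
whose rows are the linear forms and whose columns are the coefficient vectors
of the variables, each repeated as often as the monomial says.  For products
of linear forms the Nullstellensatz is obtained by applying a divided
difference in every variable ([divdiff_prod]): it returns the coefficient
and, on the other hand, only sees values on the grid.

To find the columns ([exists_difference_permanent]), add the vertices in
increasing order.  When v arrives, the new rows are those of T, the set of
representatives e with y_e = v.  Column v is 1 on T and 0 on the older rows, so
prepending |T| copies of it multiplies the old permanent by |T|! and keeps it
nonzero.  On the rows present so far, every other vertex of an e in T comes
later and is invisible, so the columns satisfy e = x_e + v.  Hence
- x_e and e agree on the old rows, and before anything else each use of a
  column x_e, e in T, can be turned into a use of e;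
- v = e - x_e, so by multilinearity each copy of v can be replaced by e or by
  x_e, one copy for each e in T, keeping the permanent nonzero.
Column e is new, so it is used at most 1 + 1 times; column x_e was just freed,
and is used at most once because the x_e, e in T, are distinct.
*)

(** * Permanents with chosen columns *)

Section Permanent.
Variables (R : comPzRingType) (I Z : finType) (A : Z -> I -> R).
Implicit Types (S T : {set I}) (z : Z) (zs : seq Z).

(** The permanent of the matrix with rows [S] and columns the [A z] for [z] in
    [zs], expanded along the first column.  Rows form a set and columns a
    sequence because rows get deleted while columns get repeated; it vanishes
    unless the matrix is square. *)
Fixpoint permanent S zs : R :=
  if zs is z :: zs' then \sum_(i in S) A z i * permanent (S :\ i) zs'
  else (S == set0)%:R.

Lemma permanent_swap S z1 z2 zs :
  permanent S [:: z1, z2 & zs] = permanent S [:: z2, z1 & zs].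
Proof.
rewrite /=; under eq_bigr => i _ do rewrite big_distrr /=.
under [RHS]eq_bigr => i _ do rewrite big_distrr /=.
rewrite [LHS](exchange_big_dep [in S]) /=; last by move=> i j _ /setD1P[].
apply: eq_bigr => j Sj; apply: eq_big => [i | i _].
  by rewrite !inE Sj andbT andbC eq_sym.
by rewrite mulrCA setDDl setUC -setDDl.
Qed.

Lemma permanent_cons S z zs zs' : permanent^~ zs =1 permanent^~ zs' ->
  permanent S (z :: zs) = permanent S (z :: zs').
Proof. by move=> eq_zs /=; apply: eq_bigr => i _; rewrite eq_zs. Qed.

Lemma permanent_catCA S z zs1 zs2 :
  permanent S (zs1 ++ z :: zs2) = permanent S (z :: zs1 ++ zs2).
Proof.
elim: zs1 S => // z1 zs1 IH S.
by rewrite permanent_swap cat_cons; apply: permanent_cons => {}S; apply: IH.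
Qed.

Lemma permanent_perm S zs zs' :
  perm_eq zs zs' -> permanent S zs = permanent S zs'.
Proof.
elim: zs zs' S => [|z zs IH] zs' S eq_zs.
  by move: eq_zs; rewrite perm_sym => /perm_nilP->.
have z_zs' : z \in zs' by rewrite -(perm_mem eq_zs) mem_head.
move: eq_zs; case/splitPr: z_zs' => zs1 zs2 eq_zs.
rewrite permanent_catCA; apply: permanent_cons => {}S; apply: IH.
rewrite -(perm_cons z); apply: perm_trans eq_zs _.
exact: permEl (perm_catCA zs1 [:: z] zs2).
Qed.

(** Expansion along a row, with equal columns grouped together. *)
Lemma permanent_row i S zs : i \in S ->
  permanent S zs =
    \sum_z (count_mem z zs)%:R * (A z i * permanent (S :\ i) (rem z zs)).
Proof.
elim: zs S => [|z0 zs IH] S Si.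
  rewrite big1 => [|z _]; last by rewrite mul0r.
  by rewrite /=; case: eqP Si => // ->; rewrite inE.
have rowE z : (count_mem z (z0 :: zs))%:R *
      (A z i * permanent (S :\ i) (rem z (z0 :: zs))) =
    (z0 == z)%:R * (A z i * permanent (S :\ i) zs) + (count_mem z zs)%:R *
      (A z i * permanent (S :\ i) (z0 :: rem z zs)).
  rewrite [count_mem _ _]/= natrD mulrDl [rem z _]/=; case: (z0 =P z) => [->|_].
    congr (_ + _); have [z_zs|] := boolP (z \in zs).
      by rewrite (permanent_perm _ (perm_to_rem z_zs)).
    by move/count_memPn->; rewrite !mul0r.
  by rewrite !mul0r.
under [RHS]eq_bigr => z _ do rewrite rowE.
rewrite big_split /= [X in _ = X + _](bigD1 z0) //= eqxx mul1r.
rewrite [X in _ + X + _]big1 ?addr0 => [|z]; last first.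
  by rewrite eq_sym => /negPf->; rewrite mul0r.
rewrite (big_setD1 i) //=; congr (_ + _).
(* Rows other than [i]: expand along column [z0] on the right, along row [i] on
   the left. *)
under [RHS]eq_bigr => z _ do rewrite !big_distrr /=.
rewrite exchange_big /=; apply: eq_bigr => j /setD1P[neq_ji Sj].
rewrite IH; last by rewrite !inE eq_sym neq_ji.
rewrite big_distrr /=; apply: eq_bigr => z _.
by rewrite setDDl setUC -setDDl; rewrite mulrCA; congr (_ * _); rewrite mulrCA.
Qed.

Lemma permanent_size S zs : permanent S zs != 0 -> #|S| = size zs.
Proof.
elim: zs S => [|z zs IH] S /=; first by case: (S =P set0) => [->|_]; rewrite ?cards0 ?eqxx.
apply: contraNeq => neq_size; apply/eqP/big1 => i Si.
have [->|/IH size_zs] := eqVneq (permanent (S :\ i) zs) 0; first exact: mulr0.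
by rewrite (cardsD1 i) Si size_zs eqxx in neq_size.
Qed.

Lemma permanent_lin S z z1 z2 zs :
    (forall i, i \in S -> A z i = A z1 i - A z2 i) ->
  permanent S (z :: zs) = permanent S (z1 :: zs) - permanent S (z2 :: zs).
Proof.
by move=> Az; rewrite /= -sumrB; apply: eq_bigr => i Si; rewrite Az // mulrBl.
Qed.

Lemma permanent_map S (f : Z -> Z) zs :
    (forall z i, z \in zs -> i \in S -> A (f z) i = A z i) ->
  permanent S (map f zs) = permanent S zs.
Proof.
elim: zs S => //= z zs IH S Af; apply: eq_bigr => i Si.
rewrite Af ?mem_head // IH // => z' j zs_z' /setD1P[_ Sj].
by rewrite Af // inE zs_z' orbT.
Qed.

(** A column that is the indicator of [T] can only be matched with rows of [T],
    so [#|T|] copies of it use up exactly these rows. *)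
Lemma permanent_nseq S T z zs : T \subset S ->
    (forall i, i \in S -> A z i = (i \in T)%:R) ->
  permanent S (nseq #|T| z ++ zs) = (#|T|)`!%:R * permanent (S :\: T) zs.
Proof.
move cardT: #|T| => n; elim: n S T cardT => [|n IH] S T cardT T_S Az.
  by rewrite (cards0_eq cardT) setD0 mul1r.
rewrite /= (eq_bigr (fun i => (i \in T)%:R * permanent (S :\ i) (nseq n z ++ zs)));
  last by move=> i Si; rewrite Az.
under eq_bigr => i _ do rewrite mulr_natl mulrb.
rewrite -big_mkcondr /= (eq_bigl (mem T)) => [|i]; last first.
  by apply: andb_idl; apply: (subsetP T_S).
rewrite (eq_bigr (fun=> n`!%:R * permanent (S :\: T) zs)) => [|i /= Ti].
  by rewrite sumr_const cardT -[LHS]mulr_natl factS natrM mulrA.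
have cardTi := cardsD1 i T; rewrite [i \in T]Ti add1n cardT in cardTi.
rewrite (IH _ (T :\ i)) ?setSD //; first last.
- by move=> j /setD1P[neq_ji Sj]; rewrite Az // !inE neq_ji.
- by case: cardTi.
congr (_ * permanent _ _); apply/setP=> j; rewrite !inE.
by case: (j =P i) => [->|_] //=; rewrite [i \in T]Ti.
Qed.

(** If column [z] is a difference of two columns in several ways, then its
    copies can be replaced one at a time, each in its own way: by linearity
    one of the two replacements keeps the permanent nonzero. *)
Lemma permanent_exchange (E : eqType) (es : seq E) (a b : E -> Z) S z zs :
    uniq es -> (forall e i, e \in es -> i \in S -> A z i = A (a e) i - A (b e) i) ->
    permanent S (nseq (size es) z ++ zs) != 0 ->
  exists h : pred E,
    permanent S ([seq if h e then a e else b e | e <- es] ++ zs) != 0.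
Proof.
elim: es zs => [|e es IH] zs /=; first by exists xpred0.
case/andP=> es'e es_uniq Az nz.
have [c nz_c]: exists c : bool,
    permanent S (nseq (size es) z ++ (if c then a e else b e) :: zs) != 0.
  move: nz; rewrite -/(permanent S (z :: _)).
  rewrite (@permanent_lin _ _ (a e) (b e)) => [|i]; last exact/Az/mem_head.
  have [a0|a_nz _] := eqVneq (permanent S (a e :: nseq (size es) z ++ zs)) 0.
    by rewrite a0 sub0r oppr_eq0; exists false; rewrite permanent_catCA.
  by exists true; rewrite permanent_catCA.
have [e' i es_e'|h nz_h] := IH _ es_uniq _ nz_c.
  by apply: Az; rewrite inE es_e' orbT.
exists (fun e' => if e' == e then c else h e').
rewrite eqxx -/(permanent S ((if c then _ else _) :: _)) -permanent_catCA.
congr (permanent S (_ ++ _) != 0): nz_h; apply/eq_in_map => e' es_e'.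
by case: eqP => // eq_e; rewrite -eq_e es_e' in es'e.
Qed.
End Permanent.

(** * A Nullstellensatz for products of linear forms *)

Section Nullstellensatz.
Variables (R : fieldType) (Z J : finType) (t : Z -> J -> R).
Implicit Types (T : Z -> {set J}) (z : Z) (k s : J) (G : {ffun Z -> J} -> R).

(** The coefficient of the value at node [t z k] in the divided difference
    over the nodes [t z j], [j] in [X]. *)
Definition divdiff_weight z (X : {set J}) k : R :=
  \prod_(j in X :\ k) (t z k - t z j)^-1.

(** The iterated divided difference, over the nodes [T z] in variable [z].  On a
    polynomial of degree at most [\sum_z (#|T z| - 1)] it returns the coefficient
    of the monomial of degree [#|T z| - 1] in each [z]. *)
Definition divdiff T G : R :=
  \sum_(w in family T) (\prod_z divdiff_weight z (T z) (w z)) * G w.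

Definition remove_node T z s : Z -> {set J} :=
  fun z' => if z' == z then T z' :\ s else T z'.

(** The factor [t z k - t z s] cancels the factor of the weight that belongs to
    the node [s]; this is the Leibniz rule for divided differences. *)
Lemma divdiff_weightM z (X : {set J}) k s : {in X &, injective (t z)} ->
  s \in X -> k \in X :\ s ->
  divdiff_weight z X k * (t z k - t z s) = divdiff_weight z (X :\ s) k.
Proof.
move=> t_inj Xs /setD1P[neq_ks Xk]; rewrite /divdiff_weight (big_setD1 s) /=.
  rewrite mulrC mulVKf; last by rewrite subr_eq0 (inj_in_eq t_inj).
  by rewrite !setDDl setUC.
by rewrite !inE eq_sym neq_ks.
Qed.

(** The divided difference of a constant vanishes, except of order 0.  For two
    nodes [s] and [s'], multiplying the sum by [t z s - t z s'] turns it into the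
    difference of the sums with [s'], respectively [s], removed; these agree by
    induction. *)
Lemma divdiff_weight_sum z (X : {set J}) : {in X &, injective (t z)} ->
  \sum_(k in X) divdiff_weight z X k = (#|X| == 1)%:R.
Proof.
have [n leXn] := ubnP #|X|; elim: n X leXn => // n IH X leXn t_inj.
have [/card_le1P|] := leqP #|X| 1.
  have [->|[k Xk]] := set_0Vmem X; first by rewrite big_set0 cards0.
  move=> /(_ k Xk) Xk1; have ->: X = [set k].
    by apply/setP=> j; rewrite Xk1 inE.
  by rewrite big_set1 cards1 /divdiff_weight setDv big_set0.
move=> X_gt1; case/card_gt1P: (X_gt1) => s [s' [Xs Xs' neq_ss']].
have drop u : u \in X -> \sum_(k in X) divdiff_weight z X k * (t z k - t z u)
                          = (#|X| == 2)%:R.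
  move=> Xu; rewrite (big_setD1 u) //= subrr mulr0 add0r.
  have cardX := cardsD1 u X; rewrite Xu add1n in cardX.
  under eq_bigr => k Xk do rewrite (divdiff_weightM t_inj Xu Xk).
  rewrite IH; first by rewrite cardX.
    by rewrite -ltnS -cardX.
  by apply: sub_in2 t_inj => j /setD1P[].
have nz: t z s - t z s' != 0 by rewrite subr_eq0 (inj_in_eq t_inj).
apply: (mulIf nz); rewrite (gtn_eqF X_gt1) mul0r.
apply: (@eq_trans _ _ ((#|X| == 2)%:R - (#|X| == 2)%:R)); last by rewrite subrr.
rewrite -{1}(drop s') // -(drop s) // -sumrB mulr_suml.
by apply: eq_bigr => k _; ring.
Qed.

Lemma divdiff1 T : (forall z, {in T z &, injective (t z)}) ->
  divdiff T (fun=> 1) = \prod_z (#|T z| == 1)%:R.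
Proof.
move=> t_inj; under [RHS]eq_bigr => z _ do rewrite -(divdiff_weight_sum (@t_inj z)).
by rewrite bigA_distr_big_dep; apply: eq_bigr => w _; rewrite mulr1.
Qed.

Lemma divdiff_eq0 T z G : T z = set0 -> divdiff T G = 0.
Proof. by move=> Tz0; apply: big1 => w /familyP/(_ z); rewrite Tz0 inE. Qed.

Lemma remove_node_inj T z s : (forall z', {in T z' &, injective (t z')}) ->
  forall z', {in remove_node T z s z' &, injective (t z')}.
Proof.
move=> t_inj z'; rewrite /remove_node; case: eqP => // _.
by apply: sub_in2 (@t_inj z') => j /setD1P[].
Qed.

(** When [s] is the only node in [T z], the right-hand side is 0, as it should
    be: [remove_node] leaves an empty set of nodes and hence an empty sum. *)
Lemma divdiff_mul T z s G : {in T z &, injective (t z)} -> s \in T z ->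
  divdiff T (fun w => (t z (w z) - t z s) * G w) = divdiff (remove_node T z s) G.
Proof.
move=> t_inj Ts; rewrite /divdiff (bigID (fun w : {ffun Z -> J} => w z == s)) /=.
rewrite big1 ?add0r => [|w /andP[_ /eqP->]]; last by rewrite subrr mul0r mulr0.
apply: eq_big => [w | w /andP[/familyP Tw neq_ws]].
  apply/andP/familyP => [[/familyP Tw neq_ws] z'|Tw].
    by rewrite /remove_node; case: eqP => [->|_]; rewrite ?inE ?neq_ws Tw.
  split; last by have := Tw z; rewrite /remove_node eqxx !inE => /andP[].
  apply/familyP => z'; have := Tw z'.
  by rewrite /remove_node; case: eqP => // _ /setD1P[].
rewrite mulrA; congr (_ * _); rewrite (bigD1 z) //= [RHS](bigD1 z) //=.
rewrite mulrAC divdiff_weightM ?inE ?neq_ws ?Tw // /remove_node eqxx.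
by congr (_ * _); apply: eq_bigr => z' /negPf->.
Qed.

Variables (I : finType) (A : Z -> I -> R).
Implicit Types (S : {set I}) (i : I).

Definition linform (w : {ffun Z -> J}) i := \sum_z A z i * t z (w z).

(** Write the linear form as a combination of the [t z (w z) - t z (s z)] plus
    its value at the grid point [s]. *)
Lemma divdiff_form T i (s : Z -> J) G : (forall z, {in T z &, injective (t z)}) ->
  (forall z, s z \in T z) ->
  divdiff T (fun w => linform w i * G w) =
    \sum_z A z i * divdiff (remove_node T z (s z)) G +
    (\sum_z A z i * t z (s z)) * divdiff T G.
Proof.
move=> t_inj Ts.
under eq_bigr => z _ do rewrite -(divdiff_mul _ (@t_inj z) (Ts z)) /divdiff big_distrr /=.
rewrite exchange_big /= [X in _ = _ + X]big_distrr /= -big_split /=.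
apply: eq_bigr => w _; rewrite /linform mulrCA [RHS]addrC !mulr_suml -big_split /=.
by apply: eq_bigr => z _; rewrite mulrBl mulrBr [X in _ = _ + X]mulrBr; ring.
Qed.

Lemma eq_divdiff T G G' : G =1 G' -> divdiff T G = divdiff T G'.
Proof. by move=> eqG; apply: eq_bigr => w _; rewrite eqG. Qed.

Lemma card_remove_node T z s z' : s \in T z ->
  #|T z'| = ((z' == z) + #|remove_node T z s z'|)%N.
Proof.
by move=> Ts; rewrite /remove_node; case: eqP => // ->; rewrite (cardsD1 s) Ts.
Qed.

(** The degree [#|S|] is less than the total order [\sum_z #|T z| - #|Z|] of the
    divided difference. *)
Lemma divdiff_prod_small T S : (forall z, {in T z &, injective (t z)}) ->
    (#|S| + #|Z| < \sum_z #|T z|)%N ->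
  divdiff T (fun w => \prod_(i in S) linform w i) = 0.
Proof.
have [n leSn] := ubnP #|S|; elim: n S T leSn => // n IH S T leSn t_inj lt_S.
have [z /eqP Tz0|/= T_gt0] := pickP (fun z => T z == set0).
  exact: divdiff_eq0 Tz0.
have /fin_all_exists[s Ts] : forall z, exists k, k \in T z.
  by move=> z; apply/set0Pn; rewrite T_gt0.
have [S0|[i Si]] := set_0Vmem S.
  rewrite (@eq_divdiff _ _ (fun=> 1)) => [|w]; last by rewrite S0 big_set0.
  rewrite divdiff1 //.
  have [z neq1|/= all1] := pickP (fun z => #|T z| != 1%N).
    by rewrite (bigD1 z) //= (negPf neq1) mul0r.
  rewrite S0 cards0 (eq_bigr (fun=> 1%N)) in lt_S => [|z _].
    by rewrite sum1_card ltnn in lt_S.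
  exact/eqP/negbFE.
have cardS := cardsD1 i S; rewrite Si add1n in cardS.
rewrite (@eq_divdiff _ _ (fun w => linform w i * \prod_(j in S :\ i) linform w j));
  last by move=> w; rewrite (big_setD1 i).
rewrite (divdiff_form _ _ t_inj Ts) (IH (S :\ i) T) // ?mulr0 ?addr0.
- rewrite big1 // => z _; rewrite IH ?mulr0 //; [| exact: remove_node_inj|].
    by rewrite -ltnS -cardS.
  rewrite (eq_bigr _ (fun z' _ => card_remove_node z' (Ts z))) big_split in lt_S.
  rewrite /= (bigD1 z) //= eqxx big1 in lt_S => [|z' /negPf-> //].
  by rewrite cardS in lt_S; exact: lt_S.
- by rewrite -ltnS -cardS.
- by apply: leq_ltn_trans lt_S; rewrite cardS leq_add2r.
Qed.

Lemma sum_count_mem (zs : seq Z) : \sum_z count_mem z zs = size zs.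
Proof.
elim: zs => [|z zs IH] /=; first exact: big1.
rewrite big_split /= IH (bigD1 z) //= eqxx big1 // => z' neq_z'.
by rewrite eq_sym (negPf neq_z').
Qed.

(** When degree and order agree, peeling off one linear form by [divdiff_form]
    is the expansion of the permanent along the corresponding row: the
    constant term drops out by [divdiff_prod_small], and the multiplicity of
    [z] in that expansion is what the factorials absorb. *)
Lemma divdiff_prod T S zs : (forall z, {in T z &, injective (t z)}) ->
    #|S| = size zs -> (forall z, #|T z| = (count_mem z zs).+1) ->
  (\prod_z (count_mem z zs)`!)%:R * divdiff T (fun w => \prod_(i in S) linform w i)
    = permanent A S zs.
Proof.
have [n lt_zs] := ubnP (size zs); elim: n S T zs lt_zs => // n IH S T zs lt_zs.
move=> t_inj cardS cardT; have [S0|[i Si]] := set_0Vmem S.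
  have zs0: zs = [::] by apply/nilP; rewrite /nilp -cardS S0 cards0.
  rewrite zs0 /= S0 eqxx big1 // mul1r.
  rewrite (@eq_divdiff _ _ (fun=> 1)) => [|w]; last by rewrite big_set0.
  by rewrite divdiff1 // big1 // => z _; rewrite cardT zs0.
have /fin_all_exists[s Ts] : forall z, exists k, k \in T z.
  by move=> z; apply/set0Pn; rewrite -card_gt0 cardT.
have cardSi := cardsD1 i S; rewrite Si add1n in cardSi.
rewrite (@eq_divdiff _ _ (fun w => linform w i * \prod_(j in S :\ i) linform w j));
  last by move=> w; rewrite (big_setD1 i).
rewrite (divdiff_form _ _ t_inj Ts) (@divdiff_prod_small T (S :\ i)) //; last first.
  rewrite (eq_bigr _ (fun z _ => cardT z)).
  under eq_bigr => z _ do rewrite -addn1.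
  by rewrite big_split /= sum_count_mem sum1_card -cardS cardSi.
rewrite mulr0 addr0 (permanent_row _ _ Si) big_distrr /=.
apply: eq_bigr => z _; rewrite mulrCA [RHS]mulrCA; congr (_ * _).
have cardT' := card_remove_node _ (Ts z).
have [z_zs|/count_memPn cnt0] := boolP (z \in zs); last first.
  rewrite cnt0 mul0r (@divdiff_eq0 _ z) ?mulr0 //.
  by apply: cards0_eq; have := cardT' z; rewrite cardT cnt0 eqxx => -[].
have cnt_gt0 : (0 < count_mem z zs)%N by rewrite -has_count has_pred1.
rewrite -(IH _ (remove_node T z (s z))) /=.
- rewrite mulrA -natrM; congr (_%:R * _).
  rewrite (bigD1 z) //= [in RHS](bigD1 z) //= count_mem_rem eqxx subn1 mulnA.
  rewrite -{1 2}(prednK cnt_gt0) factS; congr (_ * _ * _)%N.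
  apply: eq_bigr => z' neq_z'.
  by rewrite count_mem_rem eq_sym (negPf neq_z') subn0.
- by rewrite size_rem // prednK // -has_predT; apply/hasP; exists z.
- exact: remove_node_inj.
- by rewrite size_rem // -cardS cardSi.
- move=> z'; have := cardT' z'; rewrite cardT count_mem_rem eq_sym.
  case: eqP => [<-|_]; rewrite ?add0n ?add1n; last by rewrite subn0.
  by case=> <-; rewrite subn1 prednK.
Qed.

End Nullstellensatz.

Lemma subset_of_card (J : finType) (X : {set J}) n : (n <= #|X|)%N ->
  exists2 Y : {set J}, Y \subset X & #|Y| = n.
Proof.
move=> le_n; exists [set k in take n (enum X)].
  by apply/subsetP=> k; rewrite inE => /mem_take; rewrite mem_enum.
rewrite cardsE (card_uniqP _) ?take_uniq ?enum_uniq // size_takel //.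
by rewrite -cardE.
Qed.

(** A nonzero permanent makes a divided difference of the product nonzero, and
    this only involves values at points of the grid. *)
Theorem permanent_nullstellensatz (R : fieldType) (Z J I : finType)
    (t : Z -> J -> R) (A : Z -> I -> R) (S : {set I}) (zs : seq Z)
    (X : Z -> {set J}) :
    (forall z, {in X z &, injective (t z)}) ->
    (forall z, count_mem z zs < #|X z|)%N -> permanent A S zs != 0 ->
  exists2 w : Z -> J, forall z, w z \in X z &
    forall i, i \in S -> \sum_z A z i * t z (w z) != 0.
Proof.
move=> t_inj zs_lt nz; have := permanent_size nz.
have /fin_all_exists[T T_X] : forall z, exists T : {set J},
    T \subset X z /\ #|T| = (count_mem z zs).+1.
  by move=> z; have [T] := subset_of_card (zs_lt z); exists T.
have t_injT z : {in T z &, injective (t z)}.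
  by apply: sub_in2 (t_inj z) => k; apply/subsetP; case: (T_X z).
move=> cardS.
have := divdiff_prod A t_injT cardS (fun z => proj2 (T_X z)) => divE.
have [/existsP[w /andP[/familyP Tw nz_w]]|no_w] :=
    boolP [exists w : {ffun Z -> J}, (w \in family T) &&
                                     (\prod_(i in S) linform t A w i != 0)].
  exists w => [z|i Si]; first by apply: (subsetP (proj1 (T_X z))); apply: Tw.
  by apply: contraNneq nz_w => wi0; rewrite (bigD1 i) //= [linform _ _ _ _]wi0 mul0r.
case/eqP: nz; rewrite -divE [divdiff _ _ _]big1 ?mulr0 // => w Tw.
apply/eqP; rewrite mulf_eq0; apply/orP; right.
by apply: contraNT no_w => nz_w; apply/existsP; exists w; rewrite Tw.
Qed.

(** * A nonvanishing permanent for ordered hypergraphs *)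

Section OrderedHypergraph.
Variables (R : numFieldType) (V E : finType) (f : E -> {set V}).
Variables (x y : E -> V) (r : V -> nat).
Hypothesis r_inj : injective r.
Hypothesis lt_xy : forall e, (r (x e) < r (y e))%N.
Hypothesis least_xy : forall e v, (r v <= r (y e))%N ->
  (v \in f e) = (v == x e) || (v == y e).

(** The coefficient of the variable of [z] in the difference of the total
    weights of [y e] and [x e]. *)
Definition difference_coef (z : V + E) (e : E) : R :=
  match z with
  | inl v => (v == y e)%:R - (v == x e)%:R
  | inr g => (y e \in f g)%:R - (x e \in f g)%:R
  end.

(** The vertices of [g] other than [x g] and [y g] come after [y g], hence
    differ from [x e] and [y e]. *)
Lemma difference_coef_edge e g : (r (y e) <= r (y g))%N ->
  difference_coef (inr g) e =
    difference_coef (inl (x g)) e + difference_coef (inl (y g)) e.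
Proof.
move=> le_eg; have mem_g v : (r v <= r (y e))%N ->
    (v \in f g)%:R = (x g == v)%:R + (y g == v)%:R :> R.
  move=> le_v; rewrite least_xy ?(leq_trans le_v) // ![v == _]eq_sym.
  case: eqP => [<-|_]; last by rewrite add0r.
  by case: eqP (lt_xy g) => [->|_]; rewrite ?ltnn // addr0.
by rewrite /= !mem_g ?leqnn ?(ltnW (lt_xy e)) //; ring.
Qed.

Lemma difference_coef_later v e : (r (y e) < r v)%N ->
  difference_coef (inl v) e = 0.
Proof.
move=> lt_v; have neq_v u : (r u <= r (y e))%N -> v == u = false.
  by move=> le_u; apply: contraTF lt_v => /eqP->; rewrite -leqNgt.
by rewrite /= !neq_v ?leqnn ?(ltnW (lt_xy e)) // subrr.
Qed.

Variable reps : {set E}.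
Hypothesis xy_inj : {in reps &, injective (fun e => (x e, y e))}.

(** By the last conjunct, column [e] has not been used at all when the vertex
    [y e] is reached, so that both of its uses are still available there. *)
Lemma exists_difference_permanent n : exists zs : seq (V + E),
  [/\ permanent difference_coef [set e in reps | (r (y e) < n)%N] zs != 0,
      forall v, (count_mem (inl v) zs <= 1)%N,
      forall e, (count_mem (inr e) zs <= 2)%N &
      forall e, inr e \in zs -> (r (y e) < n)%N].
Proof.
elim: n => [|n [zs [nz cntV cntE lt_zs]]].
  exists [::]; split=> //=; rewrite (_ : [set e in _ | _] = set0) ?eqxx ?oner_eq0 //.
  by apply/setP=> e; rewrite !inE andbF.
set S' := [set e in _ | _] in nz; set S := [set e in _ | _].
pose T := [set e in reps | r (y e) == n].
have T_S : T \subset S.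
  by apply/subsetP=> e; rewrite !inE => /andP[-> /eqP->] /=.
have SDT : S :\: T = S'.
  apply/setP=> e; rewrite !inE; case: (e \in reps) => //=.
  by rewrite andbC ltnS leq_eqVlt; case: ltngtP.
have [T0|[e0 Te0]] := set_0Vmem T.
  exists zs; split=> // [|e /lt_zs/ltnW //]; by rewrite -SDT T0 setD0 in nz.
pose v := y e0; have rv : r v = n by move: Te0; rewrite inE => /andP[_ /eqP].
have yT e : e \in T -> y e = v.
  by rewrite inE => /andP[_ /eqP ye]; apply: r_inj; rewrite ye.
have x_inj : {in T &, injective x}.
  move=> e1 e2 T1 T2 eq_x; apply: xy_inj; last by rewrite /= eq_x !yT.
    by move: T1; rewrite inE => /andP[].
  by move: T2; rewrite inE => /andP[].
(* [g] frees the columns [x e], [e] in [T]; the old rows do not see it. *)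
pose g z := if z is inl u then
              if [pick e in T | x e == u] is Some e then inr e else inl u
            else z.
have g_inl z u : g z = inl u -> z = inl u /\ forall e, e \in T -> x e != u.
  case: z => [u'|e] //=; case: pickP => // noT [<-]; split=> // e Te.
  by have := noT e; rewrite Te => /negbT.
have g_inr z e : g z = inr e -> z = inr e \/ e \in T /\ z = inl (x e).
  case: z => [u|e'] /=; last by left.
  by case: pickP => // e1 /andP[Te1 /eqP<-] [<-]; right.
have nz_g : permanent difference_coef S' (map g zs) != 0.
  rewrite permanent_map // => -[u|//] i _; rewrite inE => /andP[_ lt_i] /=.
  case: pickP => // e /andP[Te /eqP<-].
  have := @difference_coef_edge i e; rewrite (yT e) // rv => -> //; last exact: ltnW.
  by rewrite (@difference_coef_later v) ?addr0 ?rv.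
have nz_v : permanent difference_coef S (nseq #|T| (inl v) ++ map g zs) != 0.
  rewrite permanent_nseq ?SDT //.
    by rewrite mulf_neq0 // Num.Theory.pnatr_eq0 -lt0n fact_gt0.
  move=> i; rewrite inE => /andP[reps_i]; rewrite ltnS leq_eqVlt.
  rewrite inE reps_i /=; case: eqP => [ri _ | _ lt_i]; last first.
    by apply: difference_coef_later; rewrite rv.
  have <- : y i = v by apply: r_inj; rewrite ri.
  rewrite eqxx; case: eqP (lt_xy i) => [<-|]; rewrite ?ltnn //.
  by rewrite subr0.
rewrite cardE in nz_v.
have [|h nz_h] := permanent_exchange (a := inr) (b := inl \o x) (enum_uniq T) _ nz_v.
  move=> e i; rewrite mem_enum => Te; rewrite inE ltnS => /andP[_ le_i].
  have := @difference_coef_edge i e; rewrite (yT e) // rv => -> //.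
  by rewrite [_ + difference_coef (inl v) i]addrC addrK.
(* Each [e] in [T] has put one of the columns [e] and [x e]. *)
set F := fun e => _ in nz_h.
have F_uniq : uniq (map F (enum T)).
  rewrite map_inj_in_uniq ?enum_uniq // => e1 e2; rewrite !mem_enum /F => T1 T2 /=.
  by case: (h e1); case: (h e2) => //= -[] //; apply: x_inj.
exists (map F (enum T) ++ map g zs); split=> [|u|e|e] //.
- rewrite count_cat count_uniq_mem // count_map.
  have [/mapP[e]|_] := boolP (inl u \in _); last first.
    rewrite add0n (leq_trans _ (cntV u)) //; apply: sub_count => z /=.
    by move/eqP/g_inl=> [-> _].
  rewrite mem_enum /F => Te; case: (h e) => //= -[eq_u].
  rewrite (eq_count (a2 := pred0)) ?count_pred0 // => z /=.
  by apply/eqP=> /g_inl[_ /(_ e Te)]; rewrite eq_u eqxx.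
- rewrite count_cat count_uniq_mem // count_map.
  have [Te|T'e] := boolP (e \in T).
    (* Uses of [e] after applying [g] come from uses of [x e] only. *)
    have zs'e : count_mem (inr e) zs = 0%N.
      by apply/count_memPn; apply/negP => /lt_zs; rewrite yT // rv ltnn.
    rewrite -[2%N]/(1 + 1)%N leq_add ?leq_b1 // (leq_trans _ (cntV (x e))) //.
    rewrite -[leqRHS]addn0 -zs'e -count_predUI (leq_trans _ (leq_addr _ _)) //.
    by apply: sub_count => z /eqP/g_inr[->|[_ ->]]; rewrite /= eqxx ?orbT.
  have [/mapP[e1]|_] := boolP (inr e \in _).
    by rewrite mem_enum /F => Te1; case: (h e1) => //= -[eq_e]; rewrite eq_e Te1 in T'e.
  rewrite add0n (leq_trans _ (cntE e)) //; apply: sub_count => z /=.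
  by move/eqP/g_inr=> [->|[Te]] //; rewrite Te in T'e.
- have T_lt e1 : e1 \in T -> (r (y e1) < n.+1)%N by move/yT->; rewrite rv.
  rewrite mem_cat => /orP[/mapP[e1]|/mapP[z zs_z /esym/g_inr[z_e|[/T_lt]]//]].
    by rewrite mem_enum /F => /T_lt; case: (h e1) => //= lt_e1 -[->].
  by rewrite ltnW // ltnS lt_zs // -z_e.
Qed.
End OrderedHypergraph.

(** * Vertex and edge weights from lists *)

Lemma two_least_elements (V : finType) (r : V -> nat) (e : {set V}) :
    injective r -> (1 < #|e|)%N ->
  exists p : V * V, [/\ p.1 \in e, p.2 \in e, (r p.1 < r p.2)%N &
    forall v, (r v <= r p.2)%N -> (v \in e) = (v == p.1) || (v == p.2)].
Proof.
move=> r_inj /card_gt1P[a0 [b0 [e_a0 e_b0 neq_ab0]]].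
have [a e_a a_min] := arg_minnP r e_a0.
have [b0' eD_b0'] : exists b, b \in e :\ a.
  have [eq_a|neq_a] := eqVneq a0 a; last by exists a0; rewrite !inE neq_a.
  by exists b0; rewrite !inE -eq_a eq_sym neq_ab0.
have [b /setD1P[neq_ba e_b] b_min] := arg_minnP r eD_b0'.
exists (a, b); split=> //= [|v le_vb].
  by rewrite ltn_neqAle a_min // (inj_eq r_inj) eq_sym neq_ba.
apply/idP/orP => [e_v|[] /eqP-> //]; have [->|neq_va] := eqVneq v a; first by left.
right; rewrite -(inj_eq r_inj) eqn_leq le_vb.
by apply: b_min; apply/setD1P.
Qed.

Lemma exists_representatives (E : finType) (K : eqType) (k : E -> K) :
  exists reps : {set E},
    {in reps &, injective k} /\ forall e, exists2 g, g \in reps & k g = k e.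
Proof.
pose rep e := choose (fun g => k g == k e) e.
have k_rep e : k (rep e) = k e by apply/eqP/(chooseP (P := fun g => k g == k e)).
exists [set rep e | e in E]; split=> [_ _ /imsetP[e1 _ ->] /imsetP[e2 _ ->]|e].
  rewrite !k_rep => eq_k; rewrite /rep.
  rewrite (@eq_choose _ _ (fun g => k g == k e2)) => [|g]; last by rewrite eq_k.
  by apply: choose_id; rewrite ?eq_k.
by exists (rep e); [apply: imset_f | apply: k_rep].
Qed.

Local Open Scope fset_scope.

Theorem theorem11 (R : realType) (H : hypergraph)
    (L : objects H -> {fset R})
    (size_edges : forall e : {set vertices H}, e \in edges H -> (2 <= #|e|)%N)
    (size_LV : forall v : vertices H, #|` L (inl v)| = 2%N)
    (size_LE : forall e : edge_of H, #|` L (inr e)| = 3%N) :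
  exists omega : objects H -> R,
    (forall z : objects H, omega z \in L z) /\
    proper_coloring (total_weight omega).
Proof.
pose r (v : vertices H) : nat := enum_rank v.
have r_inj : injective r by move=> v1 v2 /val_inj/enum_rank_inj.
have /fin_all_exists[p pP] (e : edge_of H) := two_least_elements r_inj (size_edges _ (valP e)).
have [reps [p_inj repsP]] := exists_representatives p.
pose x e := (p e).1; pose y e := (p e).2.
have lt_xy e : (r (x e) < r (y e))%N by case: (pP e).
have least_xy e v : (r v <= r (y e))%N -> (v \in val e) = (v == x e) || (v == y e).
  by case: (pP e) => _ _ _; apply.
have xy_inj : {in reps &, injective (fun e => (x e, y e))}.
  by move=> e1 e2 r1 r2 eq_xy; apply: p_inj => //; move: eq_xy; rewrite -!surjective_pairing.
have [zs [nz cntV cntE _]] :=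
  exists_difference_permanent R r_inj lt_xy least_xy xy_inj #|vertices H|.
rewrite (_ : [set e in reps | _] = reps) in nz; last first.
  by apply/setP=> e; rewrite inE ltn_ord andbT.
(* All lists have at most three elements, so ['I_3] indexes them; indices in
   [X z] never reach the default value 0. *)
pose t z (k : 'I_3) := nth 0 (L z) k.
pose X z := [set k : 'I_3 | (k < #|` L z|)%N].
have t_inj z : {in X z &, injective (t z)}.
  move=> k1 k2; rewrite !inE => lt1 lt2 /eqP.
  by rewrite nth_uniq ?fset_uniq // => /eqP/val_inj.
have cardX z : #|X z| = #|` L z|.
  have le3: (#|` L z| <= 3)%N by case: z => [v|e]; rewrite ?size_LV ?size_LE.
  rewrite -[RHS]card_ord -!sum1_card (big_ord_widen _ (fun=> 1%N) le3).
  by apply: eq_bigl => k; rewrite inE.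
have zs_lt z : (count_mem z zs < #|X z|)%N.
  by rewrite cardX; case: z => [v|e]; rewrite ?size_LV ?size_LE ltnS.
have [w Xw w_nz] := permanent_nullstellensatz t_inj zs_lt nz.
exists (fun z => t z (w z)); split=> [z|e e_H].
  by apply: mem_nth; have := Xw z; rewrite inE.
have [g reps_g p_g] := repsP (exist _ e e_H).
have [x_e y_e _ _] := pP (exist _ e e_H); rewrite -p_g in x_e y_e.
exists (x g), (y g); split=> // eq_w; case/eqP: (w_nz g reps_g).
transitivity (total_weight (fun z => t z (w z)) (y g) -
              total_weight (fun z => t z (w z)) (x g)); last by rewrite eq_w subrr.
rewrite big_sumType /= /total_weight opprD addrACA.
have pick_vertex u : \sum_v (v == u)%:R * t (inl v) (w (inl v)) = t (inl u) (w (inl u)).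
  rewrite (bigD1 u) //= eqxx mul1r big1 ?addr0 // => v /negPf->.
  by rewrite mul0r.
have pick_edges u : \sum_(e' : edge_of H) (u \in val e')%:R * t (inr e') (w (inr e')) =
    \sum_(e' : edge_of H | u \in val e') t (inr e') (w (inr e')).
  rewrite [RHS]big_mkcond; apply: eq_bigr => e' _.
  by case: (u \in val e'); rewrite ?mul1r ?mul0r.
rewrite -!pick_vertex -!pick_edges -!sumrB.
by congr (_ + _)%R; apply: eq_bigr => z _; exact: mulrBl.
Qed.
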